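(* Let $E_1|H_1,\ldots,E_n|H_n$ be $n$ conditional events, with $x_i=P(E_i|H_i)$, $i=1,\ldots,n$, and with $\mathbb{P}(\mathcal{C}_n)=\mu_n$, where $\mathcal{C}_n=\bigwedge_{i=1}^n(E_i|H_i)$. Then $$\max\{x_1+\cdots+x_n-(n-1),0\}\leq\mu_n\leq\min\{x_1,\ldots,x_n\}.$$
   Context: Events are two-valued propositions (identified with subsets of the sure event $\Omega$, and with their indicators); $\overline{A}$ is negation, $AB$ is conjunction. For events $E,H$ with $H\neq\emptyset$, the conditional event $E|H$ is true if $EH$ is true, false if $\overline{E}H$ is true, void if $\overline{H}$ is true. A conditional random quantity $X|H$ ($X$ with finitely many values, $H\ne\emptyset$) with assessed prevision $\mu=\mathbb{P}(X|H)$ is identified with the random quantity $XH+\mu\overline{H}$; in particular $E|H=EH+x\overline{H}$ with $x=P(E|H)$. Coherence: an assessment of previsions $\mu_j=\mathbb{P}(X_j|K_j)$ on a family of conditional random quantities is coherent if, for every finite subfamily $\{X_1|K_1,\ldots,X_r|K_r\}$ and all real $s_1,\ldots,s_r$, the gain $G=\sum_j s_jK_j(X_j-\mu_j)$ restricted to $K_1\vee\cdots\vee K_r$ satisfies $\min G\leq 0\leq\max G$. Conjunction. For each nonempty $S\subseteq\{1,\ldots,n\}$ let $x_S$ be the assessed prevision of $\mathcal{C}_S=\bigwedge_{i\in S}(E_i|H_i)$ ($x_{\{i\}}=x_i=P(E_i|H_i)$, $x_{\{1,\ldots,n\}}=\mu_n$). $\mathcal{C}_S$ is the random quantity, conditional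 on $\bigvee_{i\in S}H_i$, with value $1$ if all $E_i|H_i$, $i\in S$, are true; $0$ if at least one is false; $x_V$ if none is false and the set $V\subseteq S$ of indices of void ones is nonempty (so its value is its prevision $x_S$ when all $H_i$, $i\in S$, are false). Convention: the numbers $x_S$ always form a coherent assessment on the family of all $\mathcal{C}_S$; the assertion holds for every such coherent assessment. *)

(* Defs.v *)
From mathcomp Require Import all_boot all_order all_algebra.
From mathcomp Require Import classical_sets boolp cardinality functions reals numfun.

Set Implicit Arguments.
Unset Strict Implicit.
Unset Printing Implicit Defensive.

Import Order.TTheory GRing.Theory Num.Theory.

Local Open Scope classical_set_scope.
Local Open Scope ring_scope.

(* The sure event is the full set of a type [T]; events are sets over [T]. *)

Record cond_event (T : Type) := CondEvent {
  ce_event : set T;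
  ce_hyp : set T;
  ce_hyp_neq0 : ce_hyp !=set0 }.

Definition ce_true (T : Type) (A : cond_event T) : set T :=
  ce_event A `&` ce_hyp A.

Definition ce_false (T : Type) (A : cond_event T) : set T :=
  ~` ce_event A `&` ce_hyp A.

Definition ce_void (T : Type) (A : cond_event T) : set T := ~` ce_hyp A.

(* [X | K]; the values of [crq_val] outside [crq_hyp] play no role in the
   gain below. *)
Record cond_rq (T : Type) (R : realType) := CondRQ {
  crq_val : T -> R;
  crq_finite : finite_set (range crq_val);
  crq_hyp : set T;
  crq_hyp_neq0 : crq_hyp !=set0 }.

Definition gain (T : Type) (R : realType) (r : nat)
    (X : 'I_r -> cond_rq T R) (mu s : 'I_r -> R) (w : T) : R :=
  \sum_(j < r) s j * \1_(crq_hyp (X j)) w * (crq_val (X j) w - mu j).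

Definition is_minimum (R : realType) (A : set R) (m : R) : Prop :=
  A m /\ lbound A m.

Definition is_maximum (R : realType) (A : set R) (m : R) : Prop :=
  A m /\ ubound A m.

(* A finite nonempty subfamily is given by an injection [f] into the index
   type. The gain takes finitely many values, so its minimum and maximum over
   the nonempty union of the conditioning events always exist. *)
Definition coherent (T : Type) (R : realType) (J : Type)
    (X : J -> cond_rq T R) (mu : J -> R) : Prop :=
  forall (r : nat) (f : 'I_r -> J) (s : 'I_r -> R),
    (0 < r)%N -> injective f ->
    let G := gain (X \o f) (mu \o f) s in
    let K := \bigcup_(j in [set: 'I_r]) crq_hyp (X (f j)) in
    exists m M : R,
      [/\ is_minimum (G @` K) m, is_maximum (G @` K) M, m <= 0 & 0 <= M].

Section Conjunction.
Variables (T : Type) (R : realType) (n : nat).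
Variables (A : 'I_n -> cond_event T) (x : {set 'I_n} -> R).

Definition void_indices (S : {set 'I_n}) (w : T) : {set 'I_n} :=
  [set i in S | w \in ce_void (A i)]%SET.

(* Only the values of [x] at nonempty index sets matter: in the last branch
   below with [S] nonempty, [void_indices S w] is nonempty. *)
Definition conj_val (S : {set 'I_n}) (w : T) : R :=
  if [forall i in S, w \in ce_true (A i)] then 1
  else if [exists i in S, w \in ce_false (A i)] then 0
  else x (void_indices S w).

Definition conj_hyp (S : {set 'I_n}) : set T :=
  \bigcup_(i in [set` S]) ce_hyp (A i).

Lemma conj_val_finite (S : {set 'I_n}) : finite_set (range (conj_val S)).
Proof.
apply: (@sub_finite_set _ _ ([set 0; 1] `|` range x)).
  move=> _ [w _ <-]; rewrite /conj_val.
  case: ifP => _; first by left; right.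
  case: ifP => _; first by left; left.
  by right; exists (void_indices S w).
rewrite finite_setU; split; first exact: finite_set2.
exact/finite_image/finite_finset.
Qed.

Lemma conj_hyp_neq0 (S : {set 'I_n}) : S != finset.set0 -> conj_hyp S !=set0.
Proof.
case/set0Pn => i iS; have [w Hw] := ce_hyp_neq0 (A i).
by exists w; exists i.
Qed.

Definition nonempty_index : Type := {S : {set 'I_n} | S != finset.set0}.

Definition conj_crq (S : nonempty_index) : cond_rq T R :=
  CondRQ (@conj_val_finite (val S)) (conj_hyp_neq0 (valP S)).

(* The assessment [x S] on the conjunctions of all nonempty subfamilies is
   coherent; [x] is also the parameter of the values of the conjunctions. *)
Definition coherent_conjunctions : Prop :=
  coherent conj_crq (fun S : nonempty_index => x (val S)).

End Conjunction.

(* Main.v *)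
Require Import Defs.
From mathcomp Require Import all_boot all_order all_algebra.
From mathcomp Require Import classical_sets boolp cardinality functions reals numfun.
From mathcomp Require Import fintype finset lra.

Import Order.TTheory GRing.Theory Num.Theory.
Local Open Scope ring_scope.

(** Extend the assessment by giving the empty conjunction the prevision [1].
Then a conjunction takes the value [0] when one of its members is false, and
otherwise the prevision of the conjunction of its void members
([conj_valE]); in particular it equals its own prevision outside its
conditioning event, so the indicators in the gain are redundant and coherence
becomes a statement about linear combinations of conjunctions: a lower bound
that holds on the union of the conditioning events of the members of [U]
passes to the previsions ([le_prevision]).

A point of that union leaves void only a proper subset of [U].  Hence the
value at that point of a conjunction without false members is the prevision of
a strictly smaller conjunction, and an inequality between previsions can be
proved by induction on the number of members: at points where some member is
false it is checked by hand, elsewhere it is the induction hypothesis for the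
set of void members.  Three such inductions give that previsions are
nonnegative, that they decrease when members are added (with the empty
conjunction as a special case, so that they are at most [1]), and the
Frechet lower bound [1 - sum (1 - x_i)]. *)

Section ConjunctionPrevisions.
Set Implicit Arguments.
Unset Strict Implicit.
Local Open Scope set_scope.
Variables (T : Type) (R : realType) (n : nat).
Variables (A : 'I_n -> cond_event T) (x : {set 'I_n} -> R).

Local Notation C := (conj_val A x).
Local Notation voids := (void_indices A).

(** The value [1] at the empty set merges the first and last branches of
[conj_val]. *)
Definition prevision (S : {set 'I_n}) : R := if S == set0 then 1 else x S.

Definition some_false (S : {set 'I_n}) (w : T) : bool :=
  [exists i in S, w \in ce_false (A i)].

Lemma ce_trichotomy (i : 'I_n) (w : T) :
  [\/ [/\ w \in ce_true (A i), w \notin ce_false (A i) & w \notin ce_void (A i)],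
      [/\ w \notin ce_true (A i), w \in ce_false (A i) & w \notin ce_void (A i)]
    | [/\ w \notin ce_true (A i), w \notin ce_false (A i) & w \in ce_void (A i)]].
Proof.
rewrite /ce_true /ce_false /ce_void !(classical_sets.in_setI, classical_sets.in_setC).
by case: (w \in ce_event _); case: (w \in ce_hyp _);
  [constructor 1|constructor 3|constructor 2|constructor 3].
Qed.

Lemma conj_valE (S : {set 'I_n}) (w : T) :
  C S w = if some_false S w then 0 else prevision (voids S w).
Proof.
rewrite /conj_val /prevision -/(some_false S w).
have [/forall_inP allT|notT] := ifPn.
  have -> : some_false S w = false.
    apply/negbTE/exists_inP => -[i iS iF].
    by case: (ce_trichotomy i w) => -[]; rewrite ?iF ?allT.
  rewrite (_ : voids S w = set0) ?eqxx //; apply/setP => i; rewrite !inE.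
  apply/negbTE/negP => /andP[iS iV].
  by case: (ce_trichotomy i w) => -[]; rewrite ?iV ?allT.
case: ifPn => // noF; rewrite ifN //.
move: notT; rewrite negb_forall_in => /exists_inP[i iS iT].
apply/set0Pn; exists i; rewrite inE iS /=.
have iF : w \notin ce_false (A i) by move/exists_inPn : noF; apply.
by case: (ce_trichotomy i w) => -[]; rewrite ?(negbTE iT) ?(negbTE iF).
Qed.

Lemma voidsI (S U : {set 'I_n}) (w : T) :
  S \subset U -> voids S w = S :&: voids U w.
Proof.
move=> /subsetP SU; apply/setP => i; rewrite !inE.
by case: (boolP (i \in S)) => //= /SU ->.
Qed.

Lemma some_falseS (S U : {set 'I_n}) (w : T) :
  S \subset U -> some_false S w -> some_false U w.
Proof.
by move=> /subsetP SU /exists_inP[i /SU iU iF]; apply/exists_inP; exists i.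
Qed.

Lemma voids_proper (U : {set 'I_n}) (w : T) :
  conj_hyp A U w -> voids U w \proper U.
Proof.
move=> [i /= iU iH]; apply/properP; split.
  by apply/subsetP => j; rewrite inE => /andP[].
exists i => //; rewrite inE iU /= /ce_void classical_sets.in_setC negbK.
exact/mem_set.
Qed.

Lemma conj_val_unhyp (S : {set 'I_n}) (w : T) :
  ~ conj_hyp A S w -> C S w = prevision S.
Proof.
move=> NH.
have iV i : i \in S -> w \in ce_void (A i).
  by move=> iS; rewrite in_setE => iH; apply: NH; exists i.
rewrite conj_valE ifN; last first.
  apply/exists_inPn => i /iV iSV.
  by case: (ce_trichotomy i w) => -[]; rewrite ?iSV.
by congr prevision; apply/setP => i; rewrite inE andb_idr// => /iV.
Qed.

Lemma conj_val0 (w : T) : C set0 w = prevision set0.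
Proof. by apply: conj_val_unhyp => -[i /=]; rewrite inE. Qed.

Hypothesis hx : coherent_conjunctions A x.

(** Coherence as a transfer principle.  The bet is on all nonempty
conjunctions of members of [U], the stake on each being its total coefficient
in the list [L]; the full family makes the union of the conditioning events
exactly [conj_hyp A U], whatever sets occur in [L] and however often. *)
Lemma le_prevision (U : {set 'I_n}) (L : seq (R * {set 'I_n})) (k : R) :
  U != set0 -> all (fun p : R * {set _} => p.2 \subset U) L ->
  (forall w, conj_hyp A U w -> k <= \sum_(p <- L) p.1 * C p.2 w) ->
  k <= \sum_(p <- L) p.1 * prevision p.2.
Proof.
move=> U0 /allP LU kC.
pose D := [set Z : {S : {set 'I_n} | S != set0} | val Z \subset U].
pose stake (Z : {set 'I_n}) := \sum_(p <- L) p.1 * (p.2 == Z)%:R.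
have DU : exist _ U U0 \in D by rewrite inE /=.
have D0 : (0 < #|D|)%N by apply/card_gt0P; exists (exist _ U U0).
pose f (j : 'I_#|D|) : nonempty_index n := enum_val j.
have [m [_ [[[w wK <-] _] _ gain_le0 _]]] :=
  hx (f := f) (fun j => stake (val (f j))) D0 (@enum_val_inj _ _).
have wU : conj_hyp A U w.
  case: wK => j _ [i /= iS iH]; exists i => //=.
  have := enum_valP j; rewrite inE => /subsetP; exact.
have gainE : gain (conj_crq A x \o f)
    ((fun S : nonempty_index n => x (val S)) \o f)
    (fun j => stake (val (f j))) w
    = \sum_(p <- L) p.1 * (C p.2 w - prevision p.2).
  transitivity (\sum_(j < #|D|) \sum_(p <- L)
      p.1 * ((p.2 == val (f j))%:R * (C (val (f j)) w - prevision (val (f j))))).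
    apply: eq_bigr => j _ /=.
    have -> : x (val (f j)) = prevision (val (f j)).
      by rewrite /prevision ifN //; exact: (valP (f j)).
    rewrite -mulrA (_ : \1_ _ _ * _ = C (val (f j)) w - prevision (val (f j))).
      by rewrite /stake mulr_suml; apply: eq_bigr => p _; rewrite mulrA.
    rewrite indicE; case: (boolP (w \in _)) => [_|]; first by rewrite mul1r.
    by rewrite notin_setE => /conj_val_unhyp ->; rewrite subrr mulr0.
  rewrite exchange_big /= big_seq [RHS]big_seq; apply: eq_bigr => p pL.
  rewrite -mulr_sumr; congr (_ * _).
  (* No bet is placed on the empty conjunction, but it is constantly equal to
     its prevision, so its terms vanish on both sides. *)
  have [p0|pN0] := eqVneq p.2 set0.
    rewrite p0 conj_val0 subrr big1 // => j _.
    rewrite eq_sym (negbTE (valP (f j))) mul0r //.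
  have pD : exist _ p.2 pN0 \in D by rewrite inE /= LU.
  have fp : f (enum_rank_in pD (exist _ p.2 pN0)) = exist _ p.2 pN0.
    by rewrite /f enum_rankK_in.
  rewrite (bigD1 (enum_rank_in pD (exist _ p.2 pN0))) //= fp /= eqxx mul1r.
  rewrite big1 ?addr0 // => j jp; rewrite [_ == _](_ : _ = false) ?mul0r //.
  apply: contraNF jp => /eqP pj; apply/eqP/enum_val_inj.
  by rewrite -/(f j) -/(f _) fp; apply/val_inj.
move: gain_le0; rewrite gainE.
under eq_bigr do rewrite mulrBr.
by rewrite sumrB subr_le0; apply: le_trans; exact: kC.
Qed.

Lemma prevision_ge0 (S : {set 'I_n}) : 0 <= prevision S.
Proof.
have [m] := ubnP #|S|; elim: m S => // m IH S; rewrite ltnS => Sm.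
have [->|S0] := eqVneq S set0; first by rewrite /prevision eqxx ler01.
have := @le_prevision S [:: (1, S)] 0 S0.
rewrite big_seq1 /= subxx mul1r; apply=> // w wS.
rewrite big_seq1 mul1r conj_valE; case: ifP => // _; apply: IH.
exact: leq_trans (proper_card (voids_proper wS)) Sm.
Qed.

Lemma conj_val_ge0 (S : {set 'I_n}) (w : T) : 0 <= C S w.
Proof. by rewrite conj_valE; case: ifP => // _; exact: prevision_ge0. Qed.

(** At a point where no member of [U] is false, the void members of [S] are
among those of [U], so the comparison of the two values is again an instance
of the lemma, with a smaller [U]. *)
Lemma prevision_anti (S U : {set 'I_n}) :
  S \subset U -> prevision U <= prevision S.
Proof.
have [m] := ubnP #|U|; elim: m S U => // m IH S U; rewrite ltnS => Um SU.
have [U0|U0] := eqVneq U set0.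
  by move: SU; rewrite U0 subset0 => /eqP ->.
have := @le_prevision U [:: (1, S); (-1, U)] 0 U0.
rewrite !big_cons !big_nil /= SU subxx mul1r mulN1r addr0 subr_ge0.
apply=> // w wU; rewrite !big_cons big_nil /= mul1r mulN1r addr0 subr_ge0.
rewrite [leLHS]conj_valE; case: ifPn => [_|noF]; first exact: conj_val_ge0.
rewrite conj_valE ifN; last by apply: contra noF; exact: some_falseS.
apply: IH; first exact: leq_trans (proper_card (voids_proper wU)) Um.
by rewrite (voidsI w SU) subsetIr.
Qed.

Lemma prevision_le1 (S : {set 'I_n}) : prevision S <= 1.
Proof.
by rewrite (le_trans (prevision_anti (sub0set S))) // /prevision eqxx.
Qed.

Lemma conj_val_le1 (S : {set 'I_n}) (w : T) : C S w <= 1.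
Proof.
by rewrite conj_valE; case: ifP => // _; exact: prevision_le1.
Qed.

(** The Frechet lower bound.  When some member [i] is false, the summand
[1 - C [set i]] is [1] and pays for the whole bound. *)
Lemma prevision_frechet (S : {set 'I_n}) :
  1 <= prevision S + \sum_(i in S) (1 - prevision [set i]).
Proof.
have [m] := ubnP #|S|; elim: m S => // m IH S; rewrite ltnS => Sm.
have [->|S0] := eqVneq S set0.
  by rewrite big_set0 addr0 /prevision eqxx.
pose L := (1, S) :: [seq (-1 : R, [set i]) | i <- enum S].
have sumL (F : {set 'I_n} -> R) : F S + \sum_(i in S) (1 - F [set i])
    = \sum_(p <- L) p.1 * F p.2 + #|S|%:R.
  rewrite big_cons big_map big_enum /= mul1r sumrB sumr_const.
  under [in RHS]eq_bigr do rewrite mulN1r.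
  by rewrite sumrN addrA addrAC.
rewrite sumL -lerBlDr; apply: (le_prevision S0).
  rewrite /= subxx all_map; apply/allP => i /=.
  by rewrite mem_enum sub1set.
move=> w wS; rewrite lerBlDr -(sumL (C^~ w)).
have [|noF] := boolP (some_false S w).
  case/exists_inP => i iS iF; rewrite (bigD1 i) //= (_ : C [set i] w = 0).
    rewrite subr0 addrCA lerDl addr_ge0 ?conj_val_ge0 // sumr_ge0 // => j _.
    by rewrite subr_ge0 conj_val_le1.
  by rewrite conj_valE ifT //; apply/exists_inP; exists i; rewrite ?set11.
rewrite [C S w]conj_valE ifN //.
have VS := voids_proper wS.
apply: le_trans (IH _ (leq_trans (proper_card VS) Sm)) _; rewrite lerD2l.
rewrite [leRHS](big_setID (voids S w)) /= (setIidPr (proper_sub VS)).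
rewrite ler_wpDr ?sumr_ge0 // => [j _|]; first by rewrite subr_ge0 conj_val_le1.
apply: ler_sum => i iV.
have iS : [set i] \subset S by rewrite sub1set (subsetP (proper_sub VS)).
rewrite conj_valE ifN; last by apply: contra noF; exact: some_falseS.
by rewrite (voidsI w iS) (setIidPl _) // sub1set.
Qed.

End ConjunctionPrevisions.

Theorem theorem13 (T : Type) (R : realType) (n : nat) (hn : (0 < n)%N)
    (A : 'I_n -> cond_event T) (x : {set 'I_n} -> R)
    (hx : coherent_conjunctions A x) :
  Num.max (\sum_(i < n) x [set i]%SET - (n%:R - 1)) 0 <= x [set: 'I_n]%SET /\
  x [set: 'I_n]%SET
    <= \big[Num.min/x [set Ordinal hn]%SET]_(i < n) x [set i]%SET.
Proof.
have previsionT : prevision x setT = x setT.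
  by rewrite /prevision ifN //; apply/set0Pn; exists (Ordinal hn).
have prevision1 i : prevision x [set i] = x [set i].
  by rewrite /prevision ifN //; apply/set0Pn; exists i; rewrite set11.
split.
  rewrite ge_max -previsionT (prevision_ge0 hx) andbT.
  have := prevision_frechet hx setT.
  under eq_bigr do rewrite prevision1.
  rewrite sumrB sumr_const cardsT card_ord.
  rewrite (eq_bigl xpredT) => [|i]; last by rewrite inE.
  lra.
have le1 i : x setT <= x [set i].
  by rewrite -previsionT -prevision1; apply: (prevision_anti hx); exact: subsetT.
by elim/big_ind : _ => // a b ha hb; rewrite le_min ha hb.
Qed.
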